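(* Let $f:\mathbb{R}^2\to\mathbb{R}^2$, $f(x,y)=\mathbf a+\mathbf b x+\mathbf c y+\mathbf d xy$, be a non-degenerate bi-affine map, with folding line $L_f$. Then: 1. any line parallel to either coordinate axis is mapped by $f$ to a line; 2. any line is mapped by $f$ to a (possibly degenerate) parabola; 3. the folding parabola $P_f:=f(L_f)$ is non-degenerate (a genuine parabola); 4. the map $f$ is injective when restricted to either $L_+$ or $L_-$.
   Context: A function $f:\mathbb{R}^2\to\mathbb{R}^2$ is bi-affine if it has the form $f(x,y)=\mathbf a+\mathbf b x+\mathbf c y+\mathbf d xy$ with $\mathbf a,\mathbf b,\mathbf c,\mathbf d\in\mathbb{R}^2$. It is non-degenerate if $\mathbf d\neq\mathbf 0$ and neither $\mathbf b$ nor $\mathbf c$ is a scalar multiple of $\mathbf d$. For $\mathbf u,\mathbf v\in\mathbb{R}^2$, $|\mathbf u\ \mathbf v|$ denotes the determinant of the $2\times 2$ matrix with columns $\mathbf u,\mathbf v$. The folding line $L_f$ of a non-degenerate bi-affine $f$ is the line with equation $|\mathbf b\ \mathbf d|\,x+|\mathbf d\ \mathbf c|\,y=|\mathbf c\ \mathbf b|$; it is not parallel to either coordinate axis, since $|\mathbf b\ \mathbf d|$ and $|\mathbf d\ \mathbf c|$ are nonzero. $L_+$ and $L_-$ are the closed half planes above and below $L_f$, respectively. A degenerate parabola is either a line, or a line that doubles back on itself (i.e. a closed ray traced twice, such as $t\mapsto \mathbf u+\mathbf w t^2$ with $\mathbf w\ne \mathbf 0$, up to an affine change of parameter). *)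

(* Defs.v *)
From mathcomp Require Import all_boot all_order all_algebra.
From mathcomp Require Import classical_sets functions reals.

Set Implicit Arguments.
Unset Strict Implicit.
Unset Printing Implicit Defensive.
Import Order.TTheory GRing.Theory Num.Theory.
Local Open Scope classical_set_scope.
Local Open Scope ring_scope.

Notation plane R := ('cV[R]_2).

Definition xcoord (R : realType) (p : plane R) : R := p 0 0.
Definition ycoord (R : realType) (p : plane R) : R := p 1 0.

Definition line_param (R : realType) (p v : plane R) (t : R) : plane R :=
  p + t *: v.

Definition line (R : realType) (p v : plane R) : set (plane R) :=
  range (line_param p v).

Definition is_line (R : realType) (l : set (plane R)) : Prop :=
  exists p v : plane R, v != 0 /\ l = line p v.

(* A line is parallel to itself. *)
Definition parallel (R : realType) (l m : set (plane R)) : Prop :=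
  exists p q v : plane R, [/\ v != 0, l = line p v & m = line q v].

Definition xaxis (R : realType) : set (plane R) := [set p | ycoord p = 0].
Definition yaxis (R : realType) : set (plane R) := [set p | xcoord p = 0].
Arguments xaxis R : clear implicits.
Arguments yaxis R : clear implicits.

(* The library norm on matrices is the sup norm, hence an explicit Euclidean
   distance. *)
Definition edist (R : realType) (p q : plane R) : R :=
  Num.sqrt (\sum_(i < 2) (p i 0 - q i 0) ^+ 2).

Definition dist_to (R : realType) (p : plane R) (A : set (plane R)) : R :=
  inf [set edist p q | q in A].

(* Genuine parabolas, by focus and directrix.  The focus is off the directrix:
   otherwise the locus would be a line. *)
Definition is_parabola (R : realType) (A : set (plane R)) : Prop :=
  exists (focus : plane R) (directrix : set (plane R)),
    [/\ is_line directrix, ~ directrix focus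
      & A = [set p | edist p focus = dist_to p directrix]].

(* A closed ray traced twice is a property of a parametrized curve, not of its
   range; the parameter is only determined up to an affine change. *)
Definition doubled_ray (R : realType) (g : R -> plane R) : Prop :=
  exists (u w : plane R) (r s : R),
    [/\ w != 0, r != 0 & forall t, g t = u + (r * t + s) ^+ 2 *: w].

Definition degenerate_parabola (R : realType) (g : R -> plane R) : Prop :=
  is_line (range g) \/ doubled_ray g.

Definition biaffine (R : realType) (a b c d : plane R) (p : plane R) : plane R :=
  a + xcoord p *: b + ycoord p *: c + (xcoord p * ycoord p) *: d.

Definition nondegenerate_biaffine (R : realType) (b c d : plane R) : Prop :=
  [/\ d != 0, ~ (exists k : R, b = k *: d) & ~ (exists k : R, c = k *: d)].

Definition det2 (R : realType) (u v : plane R) : R :=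
  \det (row_mx u v : 'M[R]_2).

Definition folding_line (R : realType) (b c d : plane R) : set (plane R) :=
  [set p | det2 b d * xcoord p + det2 d c * ycoord p = det2 c b].

(* Closed half planes above and below a non-vertical line [l]: the point of [l]
   with the same abscissa is the reference for comparing ordinates. *)
Definition above (R : realType) (l : set (plane R)) : set (plane R) :=
  [set p | exists q, [/\ l q, xcoord q = xcoord p & ycoord q <= ycoord p]].
Definition below (R : realType) (l : set (plane R)) : set (plane R) :=
  [set p | exists q, [/\ l q, xcoord q = xcoord p & ycoord p <= ycoord q]].

(* Main.v *)
Require Import Defs.
From mathcomp Require Import all_boot all_order all_algebra.
From mathcomp Require Import boolp classical_sets functions reals.
From mathcomp Require Import ring lra.

Set Implicit Arguments.
Unset Strict Implicit.
Unset Printing Implicit Defensive.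
Import Order.TTheory GRing.Theory Num.Theory.
Local Open Scope classical_set_scope.
Local Open Scope ring_scope.

(** The restriction of [f] to a line [p + t v] is a quadratic curve
    [A + t B + t^2 C] with [C] a multiple of [d], namely the product of the two
    coordinates of [v] times [d].  So everything reduces to the trichotomy for
    quadratic curves.
    - If the line is parallel to an axis then [C = 0] and [B] is a nonzero
      multiple of [b + y d] or [c + x d]; non-degeneracy says precisely that
      these vectors never vanish ([image_axis_parallel_line]).
    - If [C != 0] and [B] is a multiple of [C], completing the square exhibits a
      ray traced twice ([doubled_ray_quad_curve]).
    - If [B] and [C] are independent, the curve is a parabola
      ([is_parabola_quad_curve]): moving the origin of the parameter to the
      vertex makes [B] orthogonal to [C], and in that orthogonal frame the
      focus-directrix equation reads [y = x^2].

    Along the folding line, whose direction is [(|d c|, - |b d|)], the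
    determinant [|B d|] equals [2 |b d| |d c|], which is not zero; this is why
    the folding parabola is genuine.

    For injectivity, let [phi] be the affine form that vanishes on the folding
    line.  If [f p = f q], taking determinants of [f p - f q] against [d], [b]
    and [c] shows that [p - q] is a multiple of [(|d c|, |b d|)] and that, when
    [p] and [q] are distinct, their midpoint lies on the folding line: the map
    is a fold along that line.  Two points on the same side whose midpoint is on
    the line are both on the line, and the direction [(|d c|, |b d|)] is
    transversal to it ([biaffine_inj_same_side]). *)

(** * Plane vectors in coordinates *)

Section Plane.
Variable R : realType.
Implicit Types (p q u v w : plane R).

Lemma plane_eqP p q : xcoord p = xcoord q -> ycoord p = ycoord q -> p = q.
Proof.
move=> hx hy; apply/matrixP => i j; rewrite (ord1 j).
case: i => [[|[|//]]] hi.
  by rewrite (_ : Ordinal hi = 0) //; apply/val_inj.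
by rewrite (_ : Ordinal hi = 1) //; apply/val_inj.
Qed.

Lemma xcoordD p q : xcoord (p + q) = xcoord p + xcoord q.
Proof. by rewrite /xcoord mxE. Qed.
Lemma ycoordD p q : ycoord (p + q) = ycoord p + ycoord q.
Proof. by rewrite /ycoord mxE. Qed.
Lemma xcoordN p : xcoord (- p) = - xcoord p.
Proof. by rewrite /xcoord mxE. Qed.
Lemma ycoordN p : ycoord (- p) = - ycoord p.
Proof. by rewrite /ycoord mxE. Qed.
Lemma xcoordZ k p : xcoord (k *: p) = k * xcoord p.
Proof. by rewrite /xcoord mxE. Qed.
Lemma ycoordZ k p : ycoord (k *: p) = k * ycoord p.
Proof. by rewrite /ycoord mxE. Qed.
Lemma xcoord0 : xcoord (0 : plane R) = 0.
Proof. by rewrite /xcoord mxE. Qed.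
Lemma ycoord0 : ycoord (0 : plane R) = 0.
Proof. by rewrite /ycoord mxE. Qed.

Definition coordE := (xcoordD, ycoordD, xcoordN, ycoordN, xcoordZ, ycoordZ,
  xcoord0, ycoord0).

Definition mk_plane (x y : R) : plane R := \col_i (if i == 0 then x else y).

Lemma xcoord_mk x y : xcoord (mk_plane x y) = x.
Proof. by rewrite /xcoord mxE. Qed.
Lemma ycoord_mk x y : ycoord (mk_plane x y) = y.
Proof. by rewrite /ycoord mxE. Qed.

Lemma plane_neq0 v : v != 0 -> xcoord v != 0 \/ ycoord v != 0.
Proof.
move=> v0; apply/orP; apply: contraNT v0; rewrite negb_or !negbK.
by move=> /andP[/eqP hx /eqP hy]; apply/eqP/plane_eqP; rewrite coordE.
Qed.

Lemma det2E u v : det2 u v = xcoord u * ycoord v - ycoord u * xcoord v.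
Proof.
rewrite /det2 (expand_det_row _ 0) !big_ord_recl big_ord0 /cofactor !det_mx11 !mxE.
have -> : lift 0 0 = 1 :> 'I_2 by apply/val_inj.
do 3![case: splitP => ?; rewrite ord1 // => _].
by rewrite expr0 expr1 /xcoord /ycoord; ring.
Qed.

Lemma det2_eq0_colinear u v : v != 0 -> det2 u v = 0 -> exists k, u = k *: v.
Proof.
rewrite det2E => /plane_neq0[] h0 h.
  exists (xcoord u / xcoord v); apply: plane_eqP; rewrite !coordE ?divfK //.
  by apply: (mulIf h0); rewrite mulrAC divfK //; apply/esym/subr0_eq; rewrite -h.
exists (ycoord u / ycoord v); apply: plane_eqP; rewrite !coordE ?divfK //.
by apply: (mulIf h0); rewrite mulrAC divfK //; apply/subr0_eq; rewrite -h.
Qed.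

(** Cramer's rule. *)
Lemma det2_neq0_span u v p : det2 u v != 0 ->
  exists x y, p = x *: u + y *: v.
Proof.
move=> h; exists (det2 p v / det2 u v), (det2 u p / det2 u v).
by move: h; rewrite !det2E => h; apply: plane_eqP; rewrite !coordE; field.
Qed.

Definition dot u v : R := xcoord u * xcoord v + ycoord u * ycoord v.

Lemma dot_gt0 v : v != 0 -> 0 < dot v v.
Proof.
rewrite /dot => /plane_neq0[]h; rewrite -!expr2.
  by rewrite ltr_pwDl ?sqr_ge0 // lt0r sqrf_eq0 h sqr_ge0.
by rewrite ltr_wpDl ?sqr_ge0 // lt0r sqrf_eq0 h sqr_ge0.
Qed.

Lemma edistE p q : edist p q = Num.sqrt (dot (p - q) (p - q)).
Proof.
rewrite /edist big_ord_recl big_ord1 /dot !coordE !expr2.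
by rewrite (_ : lift ord0 ord0 = 1) //; apply/val_inj.
Qed.

(** * Quadratic curves *)

(** In the frame [B], [C] the squared distance is [x^2 |B|^2 + y^2 |C|^2], so the
    foot of the perpendicular to a line directed by [B] is found by matching
    the coefficient along [B]. *)
Lemma dist_to_orthogonal_line p B C (x y : R) : dot B C = 0 ->
  dist_to (p + x *: B + y *: C) (line p B) = Num.sqrt (y ^+ 2 * dot C C).
Proof.
move=> BC.
have distE t : edist (p + x *: B + y *: C) (line_param p B t) =
    Num.sqrt ((x - t) ^+ 2 * dot B B + y ^+ 2 * dot C C).
  rewrite edistE /line_param; congr Num.sqrt.
  (* subtract the cross term, a multiple of the vanishing product B . C *)
  rewrite -[LHS]subr0 -(mulr0 (2 * (x - t) * y)) -BC /dot !coordE; ring.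
have minP : [set edist (p + x *: B + y *: C) q | q in line p B]
    (Num.sqrt (y ^+ 2 * dot C C)).
  exists (line_param p B x); first by exists x.
  by rewrite distE subrr expr0n mul0r add0r.
have lbP : lbound [set edist (p + x *: B + y *: C) q | q in line p B]
    (Num.sqrt (y ^+ 2 * dot C C)).
  move=> _ [_ [t _ <-] <-]; rewrite distE ler_sqrt.
    rewrite lerDr mulr_ge0 ?sqr_ge0 //.
    by rewrite /dot addr_ge0 // -expr2 sqr_ge0.
  by rewrite addr_ge0 // mulr_ge0 ?sqr_ge0 // /dot addr_ge0 // -expr2 sqr_ge0.
apply/eqP; rewrite eq_le /dist_to; apply/andP; split.
  by apply: ge_inf => //; exists (Num.sqrt (y ^+ 2 * dot C C)).
by apply: lb_le_inf => //; exists (Num.sqrt (y ^+ 2 * dot C C)).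
Qed.

Definition quad_curve (A B C : plane R) (t : R) : plane R :=
  A + t *: B + t ^+ 2 *: C.

Lemma quad_curve_shift A B C s t :
  quad_curve (quad_curve A B C s) (B + (2 * s) *: C) C t =
  quad_curve A B C (s + t).
Proof. by apply: plane_eqP; rewrite /quad_curve !coordE; ring. Qed.

Lemma dot_det2_neq0 B C : dot B C = 0 -> B != 0 -> C != 0 -> det2 B C != 0.
Proof.
(* Lagrange's identity *)
move=> BC B0 C0; rewrite -sqrf_eq0.
have -> : det2 B C ^+ 2 = dot B B * dot C C - dot B C ^+ 2.
  by rewrite det2E /dot; ring.
by rewrite BC expr0n subr0 mulf_neq0 // gt_eqF // dot_gt0.
Qed.

(** Vertex form.  In the frame [B], [C] at the vertex, the focus is at height [k]
    and the directrix at height [- k], where [4 k |C|^2 = |B|^2]; this choice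
    turns equality of the squared distances into [y = x^2]. *)
Lemma is_parabola_orthogonal A B C : dot B C = 0 -> B != 0 -> C != 0 ->
  is_parabola (range (quad_curve A B C)).
Proof.
move=> BC B0 C0.
have det0 := dot_det2_neq0 BC B0 C0.
have Bp := dot_gt0 B0; have Cp := dot_gt0 C0.
pose k := dot B B / (4 * dot C C).
have kC : 4 * k * dot C C = dot B B by rewrite /k; field; rewrite gt_eqF.
have kp : 0 < k by rewrite divr_gt0 // mulr_gt0.
exists (A + k *: C), (line (A - k *: C) B); split.
- by exists (A - k *: C), B.
- move=> [t _ /(congr1 (fun p => det2 B (p - (A - k *: C)))) h].
  have : 2 * k * det2 B C = 0.
    rewrite (_ : 2 * k * _ = det2 B (A + k *: C - (A - k *: C))); last first.
      by rewrite !det2E !coordE; ring.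
    by rewrite -h /line_param !det2E !coordE; ring.
  by apply/eqP; rewrite mulf_neq0 // mulf_neq0 // gt_eqF.
- have key x y : edist (A + x *: B + y *: C) (A + k *: C) =
      dist_to (A + x *: B + y *: C) (line (A - k *: C) B) <-> y = x ^+ 2.
    rewrite (_ : dist_to _ _ = Num.sqrt ((y + k) ^+ 2 * dot C C)); last first.
      rewrite -(dist_to_orthogonal_line (A - k *: C) x _ BC); congr dist_to.
      by apply: plane_eqP; rewrite !coordE; ring.
    rewrite edistE (_ : dot _ _ = x ^+ 2 * dot B B + (y - k) ^+ 2 * dot C C);
      last first.
      rewrite -[LHS]subr0 -(mulr0 (2 * x * (y - k))) -BC /dot !coordE; ring.
    have -> : (y + k) ^+ 2 * dot C C =
        y * dot B B + (y - k) ^+ 2 * dot C C by rewrite -kC; ring.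
    split=> [/eqP|->//].
    rewrite eqr_sqrt; last 2 first.
    + by rewrite addr_ge0 // mulr_ge0 ?sqr_ge0 // ltW.
    + by rewrite -kC (_ : _ + _ = (y + k) ^+ 2 * dot C C);
        [rewrite mulr_ge0 ?sqr_ge0 // ltW | ring].
    by move=> /eqP/addIr/(mulIf (lt0r_neq0 Bp)).
  apply/seteqP; split=> [_ [t _ <-]|p /=].
    by apply/key.
  have [x [y e]] := det2_neq0_span (p - A) det0.
  have -> : p = A + x *: B + y *: C by rewrite -addrA -e addrC subrK.
  by move=> /key ->; exists x.
Qed.

(** Starting the parameter at the vertex, where the velocity is orthogonal to
    the axis direction [C], reduces to the vertex form. *)
Lemma is_parabola_quad_curve A B C : det2 B C != 0 ->
  is_parabola (range (quad_curve A B C)).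
Proof.
move=> BC.
have C0 : C != 0.
  by apply: contraNneq BC => ->; rewrite det2E !coordE; apply/eqP; ring.
have Cp := dot_gt0 C0.
pose s := - dot B C / (2 * dot C C).
have -> : range (quad_curve A B C) =
    range (quad_curve (quad_curve A B C s) (B + (2 * s) *: C) C).
  apply/seteqP; split=> _ [t _ <-].
    by exists (t - s) => //; rewrite quad_curve_shift addrC subrK.
  by exists (s + t) => //; rewrite quad_curve_shift.
apply: is_parabola_orthogonal => //.
  have -> : dot (B + (2 * s) *: C) C = dot B C + 2 * s * dot C C.
    by rewrite /dot !coordE; ring.
  by rewrite /s; field; rewrite gt_eqF.
apply: contraNneq BC => h; apply/eqP.
have -> : det2 B C = det2 (B + (2 * s) *: C) C by rewrite !det2E !coordE; ring.
by rewrite h det2E !coordE; ring.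
Qed.

Lemma doubled_ray_quad_curve A C k : C != 0 ->
  doubled_ray (quad_curve A (k *: C) C).
Proof.
move=> C0; exists (A - (k / 2) ^+ 2 *: C), C, 1, (k / 2).
split; rewrite ?oner_neq0 // => t.
by apply: plane_eqP; rewrite /quad_curve !coordE; field.
Qed.

Lemma range_quad_curve0 A B : range (quad_curve A B 0) = line A B.
Proof.
rewrite /line; suff -> : quad_curve A B 0 = line_param A B by []; apply/funext => t.
by rewrite /quad_curve /line_param scaler0 addr0.
Qed.

End Plane.

(** * Bi-affine maps *)

Section Biaffine.
Variables (R : realType) (a b c d : plane R).
Implicit Types p q v : plane R.

Let f := biaffine a b c d.

(** The derivative at [t = 0] of [f] along [p + t v]. *)
Definition velocity p v : plane R :=
  xcoord v *: b + ycoord v *: c +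
  (xcoord p * ycoord v + xcoord v * ycoord p) *: d.

Lemma biaffine_line_param p v : f \o line_param p v =
  quad_curve (f p) (velocity p v) ((xcoord v * ycoord v) *: d).
Proof.
apply/funext => t; apply: plane_eqP;
  by rewrite /= /f /biaffine /line_param /quad_curve /velocity !coordE; ring.
Qed.

Lemma image_line p v : f @` line p v =
  range (quad_curve (f p) (velocity p v) ((xcoord v * ycoord v) *: d)).
Proof. by rewrite -biaffine_line_param /line image_comp. Qed.

Hypothesis hf : nondegenerate_biaffine b c d.

Lemma det2_bd_neq0 : det2 b d != 0.
Proof.
by case: hf => d0 nb _; apply/eqP => /(det2_eq0_colinear d0).
Qed.

Lemma det2_dc_neq0 : det2 d c != 0.
Proof.
case: hf => d0 _ nc; apply/eqP => h; apply: nc; apply: (det2_eq0_colinear d0).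
by rewrite -[RHS]oppr0 -h !det2E; ring.
Qed.

(** Here [velocity p v] is a multiple of [b + y d] or of [c + x d], whose
    determinants against [d] are those of [b] and [c]. *)
Lemma image_axis_parallel_line p v : v != 0 -> xcoord v * ycoord v = 0 ->
  is_line (f @` line p v).
Proof.
move=> v0 vv; rewrite image_line vv scale0r range_quad_curve0.
exists (f p), (velocity p v); split => //.
have detE : det2 (velocity p v) d = xcoord v * det2 b d - ycoord v * det2 d c.
  by rewrite /velocity !det2E !coordE; ring.
have : det2 (velocity p v) d != 0.
  rewrite detE; have [hx|hy] := plane_neq0 v0.
    move/eqP: vv; rewrite mulf_eq0 (negPf hx) /= => /eqP ->.
    by rewrite mul0r subr0 mulf_neq0 // det2_bd_neq0.
  move/eqP: vv; rewrite mulf_eq0 (negPf hy) orbF => /eqP ->.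
  by rewrite mul0r sub0r oppr_eq0 mulf_neq0 // det2_dc_neq0.
by apply: contraNneq => ->; rewrite det2E !coordE !mul0r subrr.
Qed.

Lemma image_line_parabola p v : v != 0 ->
  is_parabola (f @` line p v) \/ degenerate_parabola (f \o line_param p v).
Proof.
move=> v0; have [vv|vv] := eqVneq (xcoord v * ycoord v) 0.
  right; left.
  by have := image_axis_parallel_line p v0 vv; rewrite /line image_comp.
case: hf => d0 _ _.
have C0 : (xcoord v * ycoord v) *: d != 0 by rewrite scaler_eq0 negb_or vv.
have [BC|BC] := eqVneq (det2 (velocity p v) ((xcoord v * ycoord v) *: d)) 0.
  right; right; rewrite biaffine_line_param.
  by have [k ->] := det2_eq0_colinear C0 BC; apply: doubled_ray_quad_curve.
by left; rewrite image_line; apply: is_parabola_quad_curve.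
Qed.

Lemma folding_line_param : folding_line b c d =
  line (mk_plane (det2 c b / det2 b d) 0) (mk_plane (det2 d c) (- det2 b d)).
Proof.
have hb := det2_bd_neq0.
apply/seteqP; split=> [p /= hp|_ [t _ <-] /=].
  exists (- (ycoord p / det2 b d)) => //.
  apply: plane_eqP; rewrite /line_param !coordE !(xcoord_mk, ycoord_mk).
    by rewrite -hp; field.
  by field.
by rewrite /folding_line /line_param /= !coordE !(xcoord_mk, ycoord_mk); field.
Qed.

Lemma image_folding_line : is_parabola (f @` folding_line b c d).
Proof.
have hb := det2_bd_neq0; have hc := det2_dc_neq0.
rewrite folding_line_param image_line; apply: is_parabola_quad_curve.
rewrite !(xcoord_mk, ycoord_mk).
set B := velocity _ _.
have -> : det2 B ((det2 d c * - det2 b d) *: d) =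
    - (2 * (det2 d c * det2 b d) ^+ 2).
  have BdE : det2 B d = 2 * (det2 d c * det2 b d).
    rewrite (_ : det2 B d = det2 d c * det2 b d - - det2 b d * det2 d c).
      by ring.
    by rewrite /B /velocity !(xcoord_mk, ycoord_mk) !det2E !coordE; ring.
  have -> : det2 B ((det2 d c * - det2 b d) *: d) =
      - (det2 d c * det2 b d) * det2 B d.
    by rewrite [LHS]det2E [det2 B d]det2E !coordE; ring.
  by rewrite BdE; ring.
by rewrite oppr_eq0 mulf_neq0 ?pnatr_eq0 ?expf_neq0 ?mulf_neq0.
Qed.

(** Its sign tells the two sides of the folding line apart; multiplying by
    [|d c|], the coefficient of the ordinate, turns this into above and below. *)
Definition folding_form p : R :=
  det2 b d * xcoord p + det2 d c * ycoord p - det2 c b.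

Lemma biaffine_inj_same_side p q :
  0 <= folding_form p * folding_form q -> f p = f q -> p = q.
Proof.
move=> pq fpq; have hb := det2_bd_neq0; have hc := det2_dc_neq0.
set dx := xcoord p - xcoord q; set dy := ycoord p - ycoord q.
have det0 u : det2 (f p - f q) u = 0.
  by rewrite fpq subrr det2E !coordE !mul0r subrr.
pose m := (xcoord p + xcoord q) * dy + (ycoord p + ycoord q) * dx.
have diffE : f p - f q = dx *: b + dy *: c + (m / 2) *: d.
  by apply: plane_eqP; rewrite /f /biaffine /m /dx /dy !coordE; field.
have hd : det2 b d * dx = det2 d c * dy.
  apply/subr0_eq; rewrite -(det0 d) diffE [in RHS]det2E.
  by rewrite !det2E !coordE; ring.
have hb2 : 2 * (det2 c b * dy) = det2 b d * m.
  by apply/subr0_eq; rewrite -(mulr0 2) -(det0 b) diffE !det2E !coordE; field.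
have hc2 : 2 * (det2 c b * dx) = det2 d c * m.
  by apply/subr0_eq; rewrite -(mulr0 (- 2)) -(det0 c) diffE !det2E !coordE; field.
(* the midpoint of p and q is on the folding line unless p = q *)
have my : (folding_form p + folding_form q) * dy = 0.
  rewrite (_ : _ * dy = det2 b d * m - 2 * (det2 c b * dy)).
    by rewrite hb2 subrr.
  transitivity (det2 b d * (xcoord p + xcoord q) * dy
    + (ycoord p + ycoord q) * (det2 d c * dy) - 2 * (det2 c b * dy)).
    by rewrite /folding_form; ring.
  by rewrite -hd /m; ring.
have mx : (folding_form p + folding_form q) * dx = 0.
  rewrite (_ : _ * dx = det2 d c * m - 2 * (det2 c b * dx)).
    by rewrite hc2 subrr.
  transitivity (det2 d c * (ycoord p + ycoord q) * dx
    + (xcoord p + xcoord q) * (det2 b d * dx) - 2 * (det2 c b * dx)).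
    by rewrite /folding_form; ring.
  by rewrite hd /m; ring.
suff [x0 y0] : dx = 0 /\ dy = 0.
  by apply: plane_eqP; apply/subr0_eq.
have [s0|s0] := eqVneq (folding_form p + folding_form q) 0; last first.
  by split; apply: (mulfI s0); rewrite ?mx ?my mulr0.
have p0 : folding_form p = 0.
  move: pq; rewrite -(addr0_eq s0) mulrN oppr_ge0 -expr2 => h.
  by apply/eqP; rewrite -sqrf_eq0 eq_le h sqr_ge0.
have q0 : folding_form q = 0 by rewrite -s0 p0 add0r.
have sum0 : det2 b d * dx + det2 d c * dy = 0.
  transitivity (folding_form p - folding_form q); last by rewrite p0 q0 subrr.
  by rewrite /folding_form /dx /dy; ring.
have two0 k : k + k = 0 -> k = 0 :> R by move=> h; lra.
split.
  by apply: (mulfI hb); rewrite mulr0; apply: two0; rewrite -[RHS]sum0 -hd.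
by apply: (mulfI hc); rewrite mulr0; apply: two0; rewrite -[RHS]sum0 hd.
Qed.

Lemma above_folding_form p : above (folding_line b c d) p ->
  0 <= det2 d c * folding_form p.
Proof.
move=> [q [/= Lq xq yq]].
have -> : det2 d c * folding_form p = det2 d c ^+ 2 * (ycoord p - ycoord q).
  by rewrite /folding_form -Lq xq; ring.
by rewrite mulr_ge0 ?sqr_ge0 // subr_ge0.
Qed.

Lemma below_folding_form p : below (folding_line b c d) p ->
  det2 d c * folding_form p <= 0.
Proof.
move=> [q [/= Lq xq yq]].
have -> : det2 d c * folding_form p = det2 d c ^+ 2 * (ycoord p - ycoord q).
  by rewrite /folding_form -Lq xq; ring.
by rewrite mulr_ge0_le0 ?sqr_ge0 // subr_le0.
Qed.

Lemma same_side p q :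
  0 <= (det2 d c * folding_form p) * (det2 d c * folding_form q) ->
  0 <= folding_form p * folding_form q.
Proof.
by rewrite mulrACA -expr2 pmulr_rge0 // lt0r sqrf_eq0 det2_dc_neq0 sqr_ge0.
Qed.

Lemma inj_above : {in above (folding_line b c d) &, injective f}.
Proof.
move=> p q /set_mem/above_folding_form hp /set_mem/above_folding_form hq.
by apply/biaffine_inj_same_side/same_side/mulr_ge0.
Qed.

Lemma inj_below : {in below (folding_line b c d) &, injective f}.
Proof.
move=> p q /set_mem/below_folding_form hp /set_mem/below_folding_form hq.
by apply/biaffine_inj_same_side/same_side/mulr_le0.
Qed.

End Biaffine.

(** * Lines parallel to the axes, and the theorem *)

Lemma xaxis_direction (R : realType) (q v : plane R) :
  xaxis R = line q v -> ycoord v = 0.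
Proof.
move=> h; have onl t : ycoord (line_param q v t) = 0.
  by change (xaxis R (line_param q v t)); rewrite h; exists t.
have -> : v = line_param q v 1 - line_param q v 0.
  by rewrite /line_param scale1r scale0r addr0 addrAC subrr add0r.
by rewrite ycoordD ycoordN !onl subrr.
Qed.

Lemma yaxis_direction (R : realType) (q v : plane R) :
  yaxis R = line q v -> xcoord v = 0.
Proof.
move=> h; have onl t : xcoord (line_param q v t) = 0.
  by change (yaxis R (line_param q v t)); rewrite h; exists t.
have -> : v = line_param q v 1 - line_param q v 0.
  by rewrite /line_param scale1r scale0r addr0 addrAC subrr add0r.
by rewrite xcoordD xcoordN !onl subrr.
Qed.

Theorem theorem1 (R : realType) (a b c d : plane R)
    (hf : nondegenerate_biaffine b c d) :
  let f := biaffine a b c d in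
  let L := folding_line b c d in
  [/\ forall l : set (plane R), is_line l ->
        parallel l (xaxis R) \/ parallel l (yaxis R) -> is_line (f @` l),
      forall p v : plane R, v != 0 ->
        is_parabola (f @` line p v) \/
        degenerate_parabola (f \o line_param p v),
      is_parabola (f @` L)
    & {in above L &, injective f} /\ {in below L &, injective f}].
Proof.
move=> f L; split.
- move=> l _ [] [p [q [v [v0 -> h]]]]; apply: image_axis_parallel_line => //.
    by rewrite (xaxis_direction h) mulr0.
  by rewrite (yaxis_direction h) mul0r.
- exact: image_line_parabola.
- exact: image_folding_line.
- by split; [exact: inj_above | exact: inj_below].
Qed.
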